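(* Let $\mathcal{T}_h$ be a simplicial mesh of $\Omega$. If $\mathcal{T}_h$ satisfies $$\hat{\boldsymbol{q}}_i^T\,(F_K')^{-1}\,\mathbb{D}_K\,(F_K')^{-T}\,\hat{\boldsymbol{q}}_j\le 0,\qquad\forall\, i\ne j,\; i,j=1,\dots,d+1,\quad\forall K\in\mathcal{T}_h,$$ then the linear finite element scheme for the boundary value problem $-\nabla\cdot(\mathbb{D}\nabla u)=f$ in $\Omega$, $u=g$ on $\partial\Omega$ (as defined in the context, with quadrature) satisfies the discrete maximum principle (DMP).
   Context: Problem. $d\in\{1,2,3\}$; $\Omega\subset\mathbb{R}^d$ is a connected (bounded) interval, polygon or polyhedron; $f$ and $g$ are given functions; $\mathbb{D}=\mathbb{D}(\boldsymbol{x})$ is a $d\times d$ diffusion matrix, symmetric and strictly positive definite on $\Omega$. The boundary value problem is $-\nabla\cdot(\mathbb{D}\nabla u)=f$ in $\Omega$, $u=g$ on $\partial\Omega$. Mesh. $\mathcal{T}_h$ is a simplicial triangulation of $\Omega$ with $N_v$ vertices $\boldsymbol{a}_1,\dots,\boldsymbol{a}_{N_v}$, ordered so that the first $N_{vi}$ are the interior ones and the remaining ones lie on $\partial\Omega$. $\phi_j$ is the continuous piecewise linear basis function of the vertex $\boldsymbol{a}_j$. $\hat K$ is a fixed reference simplex; for $K\in\mathcal{T}_h$, $F_K$ is the affine map with $K=F_K(\hat K)$ and $F_K'$ is its (constant) Jacobian matrix; $|K|$ is the volume of $K$. Quadrature. A quadrature rule $\int_{\hat K} v\,d\xi\approx|\hat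 K|\sum_{k=1}^m\hat w_k v(\hat b_k)$ on $\hat K$, with weights $\hat w_k$ satisfying $\sum_{k=1}^m\hat w_k=1$ and quadrature nodes $\hat b_k$, is fixed. Put $b_k^K=F_K(\hat b_k)$ and $\mathbb{D}_K=\sum_{k=1}^m\hat w_k\,\mathbb{D}(b_k^K)$. Scheme. Let $U_0^h=\mathrm{span}\{\phi_1,\dots,\phi_{N_{vi}}\}$. The linear finite element scheme is: find $u^h=\sum_{j=1}^{N_v}u_j\phi_j$ with $u_j=g(\boldsymbol{a}_j)$ for $j=N_{vi}+1,\dots,N_v$ such that $$\sum_{K\in\mathcal{T}_h}|K|\,(\nabla v^h|_K)^T\mathbb{D}_K\nabla u^h|_K=\sum_{K\in\mathcal{T}_h}|K|\sum_{k=1}^m\hat w_k f(b_k^K)\,v^h(b_k^K)\qquad\forall v^h\in U_0^h.$$ DMP. The discrete maximum principle is the discrete counterpart of the maximum principle of the continuous problem: whenever $f(\boldsymbol{x})\le0$ for all $\boldsymbol{x}\in\Omega$, the solution of the scheme satisfies $\max_{\boldsymbol{x}\in\Omega\cup\partial\Omega}u^h(\boldsymbol{x})\le\max\{0,\max_{\boldsymbol{s}\in\partial\Omega}u^h(\boldsymbol{s})\}$. $\hat{\boldsymbol{q}}$-vectors of the reference element. If $\hat{\boldsymbol{a}}_1,\dots,\hat{\boldsymbol{a}}_{d+1}$ are the vertices of $\hat K$ and $\hat E=[\hat{\boldsymbol{a}}_2-\hat{\boldsymbol{a}}_1,\dots,\hat{\boldsymbol{a}}_{d+1}-\hat{\boldsymbol{a}}_1]$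 (a nonsingular $d\times d$ matrix), then the column vectors $\hat{\boldsymbol{q}}_i$ are defined by $[\hat{\boldsymbol{q}}_2,\dots,\hat{\boldsymbol{q}}_{d+1}]=\hat E^{-T}$ and $\hat{\boldsymbol{q}}_1=-\sum_{i=2}^{d+1}\hat{\boldsymbol{q}}_i$.
   Formalization: The quadrature weights are assumed nonnegative (the claim fails for weights 2, −1), the quadrature nodes are assumed to lie in the closed reference simplex, and the diffusion matrix is also assumed symmetric positive definite at any quadrature node lying on the boundary. *)

(* Defs.v *)
From HB Require Import structures.
From mathcomp Require Import all_boot all_order all_algebra.
From mathcomp Require Import all_classical all_reals all_analysis.

Set Implicit Arguments.
Unset Strict Implicit.
Unset Printing Implicit Defensive.

Import Order.TTheory GRing.Theory Num.Theory.
Import numFieldNormedType.Exports.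

Local Open Scope classical_set_scope.
Local Open Scope ring_scope.

(* Points of R^d are column vectors ['cV[R]_d].  Indices are 0-based: the
   vertices 1, ..., d+1 of a simplex are ['I_d.+1], with [ord0] for 1 and
   [lift ord0 k] for k+2. *)

Definition frontier (T : topologicalType) (A : set T) : set T :=
  closure A `\` interior A.

Definition spd (R : realType) (d : nat) (A : 'M[R]_d) : Prop :=
  A^T = A /\ forall x : 'cV[R]_d, x != 0 -> 0 < (x^T *m A *m x) 0 0.

Section Simplices.
Context (R : realType) (d : nat).
Implicit Types (p : 'I_d.+1 -> 'cV[R]_d) (x : 'cV[R]_d).

Definition hull (n : nat) (a : 'I_n -> 'cV[R]_d) (S : {set 'I_n}) :
    set 'cV[R]_d :=
  [set x | exists l : 'I_n -> R,
    [/\ forall i, 0 <= l i, forall i, i \notin S -> l i = 0,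
        \sum_i l i = 1 & x = \sum_i l i *: a i]].

Definition simplex p : set 'cV[R]_d := hull p [set: 'I_d.+1]%SET.

(* [p_2 - p_1, ..., p_(d+1) - p_1] *)
Definition edge_mx p : 'M[R]_d :=
  \matrix_(r, c) (p (lift ord0 c) - p ord0) r 0.

(* Lebesgue measure of a simplex; the library has no Lebesgue measure on
   ['cV[R]_d]. *)
Definition volume p : R := `|\det (edge_mx p)| / d`!%:R.

Definition barycenter p : 'cV[R]_d := (d.+1%:R)^-1 *: \sum_i p i.

Definition bary p x (i : 'I_d.+1) : R :=
  let t := invmx (edge_mx p) *m (x - p ord0) in
  if unlift ord0 i is Some k then t k 0 else 1 - \sum_k t k 0.

Definition qvec p (i : 'I_d.+1) : 'cV[R]_d :=
  let Q := (invmx (edge_mx p))^T in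
  if unlift ord0 i is Some k then col k Q else - \sum_k col k Q.

Definition grad (v : 'cV[R]_d -> R) x : 'cV[R]_d :=
  \col_i 'D_(delta_mx i 0) v x.

(* Open bounded interval / polygon / polyhedron: the closure is a finite union
   of nondegenerate simplices.  Regular openness excludes slits and punctures. *)
Definition polytopal_domain (Omega : set 'cV[R]_d) : Prop :=
  [/\ Omega !=set0, connected Omega, bounded_set Omega, regopen Omega &
      exists (n : nat) (s : 'I_n -> 'I_d.+1 -> 'cV[R]_d),
        (forall k, edge_mx (s k) \in unitmx) /\
        closure Omega = \bigcup_k simplex (s k)].

End Simplices.

(* [vtx] lists the vertices, interior ones first ([nvi] of them); [loc K i] is
   the global index of the i-th vertex of the element K. *)
Record mesh (R : realType) (d : nat) := Mesh {
  nv : nat;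
  nvi : nat;
  vtx : 'I_nv -> 'cV[R]_d;
  nelt : nat;
  loc : 'I_nelt -> 'I_d.+1 -> 'I_nv }.

Section Mesh.
Context (R : realType) (d : nat) (T : mesh R d).
Implicit Types (K : 'I_(nelt T)) (j : 'I_(nv T)).

Definition evtx K (i : 'I_d.+1) : 'cV[R]_d := vtx (loc K i).

Definition elt K : set 'cV[R]_d := simplex (evtx K).

Definition vset K : {set 'I_(nv T)} := [set loc K i | i : 'I_d.+1]%SET.

Record triangulation (Omega : set 'cV[R]_d) : Prop := Triangulation {
  tri_vtx_inj : injective (@vtx R d T);
  tri_vtx_used : forall j, exists K, j \in vset K;
  tri_elt_inj : injective vset;
  tri_nondegenerate : forall K, edge_mx (evtx K) \in unitmx;
  tri_conforming : forall K K',
    elt K `&` elt K' = hull (@vtx R d T) (vset K :&: vset K')%SET;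
  tri_cover : closure Omega = \bigcup_K elt K;
  tri_nvi : (nvi T <= nv T)%N;
  tri_interior : forall j, (j < nvi T)%N -> Omega (vtx j);
  tri_boundary : forall j, (nvi T <= j)%N -> frontier Omega (vtx j) }.

(* On a conforming mesh the value does not depend on the element picked.
   Outside the mesh the value is 0. *)
Definition phi j (x : 'cV[R]_d) : R :=
  if [pick K | x \in elt K] is Some K
  then \sum_(i | loc K i == j) bary (evtx K) x i else 0.

(* Gradient on K of a function that is affine on K: it is constant on the
   interior of K, and is taken at the barycenter. *)
Definition gradK (v : 'cV[R]_d -> R) K : 'cV[R]_d :=
  grad v (barycenter (evtx K)).

Definition U0h (v : 'cV[R]_d -> R) : Prop :=
  exists c : 'I_(nv T) -> R,
    v = (fun x => \sum_(j : 'I_(nv T) | (j < nvi T)%N) c j * phi j x).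

Section Scheme.
Context (ahat : 'I_d.+1 -> 'cV[R]_d).  (* vertices of the reference simplex *)
Context (m : nat) (w : 'I_m -> R) (bhat : 'I_m -> 'cV[R]_d).
Context (D : 'cV[R]_d -> 'M[R]_d) (f g : 'cV[R]_d -> R).

(* F_K is the affine map sending the i-th vertex of the reference simplex to
   the i-th vertex of K, and [jacF K] is its Jacobian matrix. *)
Definition jacF K : 'M[R]_d := edge_mx (evtx K) *m invmx (edge_mx ahat).

Definition mapF K (xi : 'cV[R]_d) : 'cV[R]_d :=
  evtx K ord0 + jacF K *m (xi - ahat ord0).

Definition qnode K (k : 'I_m) : 'cV[R]_d := mapF K (bhat k).

Definition DK K : 'M[R]_d := \sum_k w k *: D (qnode K k).

Definition fe_solution (uh : 'cV[R]_d -> R) : Prop :=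
  exists u : 'I_(nv T) -> R,
    [/\ uh = (fun x => \sum_j u j * phi j x),
        forall j, (nvi T <= j)%N -> u j = g (vtx j) &
        forall vh, U0h vh ->
          \sum_K volume (evtx K)
            * (((gradK vh K)^T *m DK K *m gradK uh K) 0 0)
          = \sum_K volume (evtx K)
            * \sum_k w k * f (qnode K k) * vh (qnode K k)].

(* A finite element function is continuous on the compact set [closure Omega],
   so the suprema below are maxima. *)
Definition dmp (Omega : set 'cV[R]_d) : Prop :=
  (forall x, Omega x -> f x <= 0) ->
  forall uh, fe_solution uh ->
    sup (uh @` closure Omega) <= Num.max 0 (sup (uh @` frontier Omega)).

Definition nonobtuse_condition : Prop :=
  forall K (i j : 'I_d.+1), i != j ->
    ((qvec ahat i)^T *m invmx (jacF K) *m DK K *m (invmx (jacF K))^T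
      *m qvec ahat j) 0 0 <= 0.

End Scheme.
End Mesh.

Arguments dmp {R d} T ahat {m} w bhat D f g Omega.
Arguments nonobtuse_condition {R d} T ahat {m} w bhat D.
Arguments qnode {R d} T ahat {m} bhat K k.
Arguments triangulation {R d} T Omega.

(* Main.v *)
Require Import Defs.
From HB Require Import structures.
From mathcomp Require Import all_boot all_order all_algebra.
From mathcomp Require Import all_classical all_reals all_analysis.
Import Order.TTheory GRing.Theory Num.Theory.
Import numFieldNormedType.Exports.
Local Open Scope classical_set_scope.
Local Open Scope ring_scope.

(** The proof is an energy argument with a truncated test function.

    Let [M] be the larger of [0] and the supremum of [uh] on the boundary, and
    test the scheme with the finite element function [vh] whose nodal values are
    the positive parts of [u_j - M]; they vanish at the boundary vertices.  On an
    element [K] the gradients of the barycentric coordinates are the [q]-vectors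
    of [K] itself, the images of those of the reference element under the inverse
    transpose of the Jacobian ([qvec_affine_image]).  The mesh condition thus
    says that the off-diagonal entries of the local stiffness matrix are
    nonpositive, which gives, element by element,
      (grad vh)^T D_K (grad vh) <= (grad vh)^T D_K (grad uh)
    ([nonobtuse_energy]).  The right-hand side of the scheme is nonpositive
    ([load_le0]), so [grad vh] vanishes on every element because [D_K], a convex
    combination of positive definite matrices, is positive definite.  Hence the
    nodal values of [vh] agree at the vertices of each element.  If some of them
    were nonzero, a vertex carrying one, extremal in a coordinate direction,
    would be interior; yet the elements around an interior vertex cover a
    neighbourhood of it, so one of them would have a vertex farther out with the
    same value ([elementwise_constant_eq0]).  So [u_j <= M] at all vertices, and
    [uh] is a convex combination of nodal values at each point.

    The sign of the right-hand side is delicate at quadrature nodes on the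
    boundary, where the sign of [f] is unknown.  There [vh] must vanish: a point
    of an element with positive barycentric weight at an interior vertex is in
    [Omega] ([open_star]).  This uses regular openness, since near such a point
    all of space is covered by the elements around that vertex. *)

(** * Barycentric coordinates and q-vectors of a simplex *)

Section Simplex.
Set Implicit Arguments.
Unset Strict Implicit.
Unset Printing Implicit Defensive.
Context (R : realType) (d : nat).
Implicit Types (p : 'I_d.+1 -> 'cV[R]_d) (x y : 'cV[R]_d) (l c : 'I_d.+1 -> R).

Lemma mx11_dotE (n : nat) (a b : 'cV[R]_n) :
  (a^T *m b) 0 0 = \sum_r a r 0 * b r 0.
Proof. by rewrite mxE; apply: eq_bigr => r _; rewrite mxE. Qed.

Lemma bary_lift p x k :
  bary p x (lift ord0 k) = (invmx (edge_mx p) *m (x - p ord0)) k 0.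
Proof. by rewrite /bary liftK. Qed.

Lemma bary_sum1 p x : \sum_i bary p x i = 1.
Proof.
rewrite big_ord_recl {1}/bary unlift_none.
by under [in X in _ + X]eq_bigr => k _ do rewrite bary_lift; rewrite subrK.
Qed.

Lemma qvec_lift p k : qvec p (lift ord0 k) = col k (invmx (edge_mx p))^T.
Proof. by rewrite /qvec liftK. Qed.

Lemma qvec_sum0 p : \sum_i qvec p i = 0.
Proof.
rewrite big_ord_recl {1}/qvec unlift_none.
by under [in X in _ + X]eq_bigr => k _ do rewrite qvec_lift; rewrite addNr.
Qed.

(** Barycentric coordinates are affine with gradient [qvec p i]; the offset
    at [p ord0] is the coordinate of that vertex itself. *)
Lemma bary_linE p x i :
  bary p x i = (i == ord0)%:R + ((qvec p i)^T *m (x - p ord0)) 0 0.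
Proof.
have E k : (invmx (edge_mx p) *m (x - p ord0)) k 0 =
    ((col k (invmx (edge_mx p))^T)^T *m (x - p ord0)) 0 0.
  by rewrite [LHS]mxE mx11_dotE; apply: eq_bigr => r _; rewrite !mxE.
rewrite /bary /qvec; case: unliftP => [k|] ->.
  by rewrite eq_sym -(negbK (ord0 == _)) neq_lift /= add0r E.
rewrite eqxx; congr (_ + _).
under eq_bigr => k _ do rewrite E.
rewrite linearN /= mulNmx mxE [X in _ = - (X *m _) _ _]linear_sum.
by rewrite mulmx_suml summxE.
Qed.

Lemma baryB p x y i : bary p y i - bary p x i = ((qvec p i)^T *m (y - x)) 0 0.
Proof.
have -> : y - x = (y - p ord0) - (x - p ord0) by rewrite opprB addrA subrK.
rewrite !bary_linE [in RHS]mulmxBr opprD addrACA subrr add0r.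
by rewrite [RHS]mxE; congr (_ + _); rewrite [RHS]mxE.
Qed.

Lemma bary_segment p x y (t : R) i :
  bary p (x + t *: (y - x)) i = (1 - t) * bary p x i + t * bary p y i.
Proof.
rewrite -[LHS](subrK (bary p x i)) baryB [x + _]addrC addrK -scalemxAr mxE.
by rewrite -baryB mulrBr mulrBl mul1r addrC addrA addrAC.
Qed.

Lemma edge_mx_mulE p (t : 'cV[R]_d) :
  edge_mx p *m t = \sum_k t k 0 *: (p (lift ord0 k) - p ord0).
Proof.
apply/colP => r; rewrite mxE summxE; apply: eq_bigr => k _.
by rewrite !mxE mulrC.
Qed.

Lemma affine_combE p l : \sum_i l i = 1 ->
  \sum_i l i *: p i =
  p ord0 + \sum_k l (lift ord0 k) *: (p (lift ord0 k) - p ord0).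
Proof.
rewrite !big_ord_recl => /(canRL (addrK _)) ->.
under [in RHS]eq_bigr => k _ do rewrite scalerBr.
rewrite sumrB -scaler_suml scalerBl scale1r -addrA; congr (_ + _).
by rewrite addrC.
Qed.

Lemma bary_affine_comb p l : edge_mx p \in unitmx -> \sum_i l i = 1 ->
  bary p (\sum_i l i *: p i) =1 l.
Proof.
move=> pU l1 i; rewrite /bary affine_combE// addrAC subrr add0r.
have <- : edge_mx p *m (\col_k l (lift ord0 k)) =
    \sum_k l (lift ord0 k) *: (p (lift ord0 k) - p ord0).
  by rewrite edge_mx_mulE; apply: eq_bigr => k _; rewrite mxE.
rewrite mulKmx//; case: unliftP => [k|] ->; first by rewrite mxE.
under eq_bigr => k _ do rewrite mxE.
by rewrite -l1 big_ord_recl addrK.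
Qed.

Lemma bary_reconstruct p x : edge_mx p \in unitmx ->
  \sum_i bary p x i *: p i = x.
Proof.
move=> pU; rewrite affine_combE ?bary_sum1//.
under eq_bigr => k _ do rewrite bary_lift.
by rewrite -edge_mx_mulE mulKVmx// addrC subrK.
Qed.

Lemma bary_vertex p i k : edge_mx p \in unitmx -> bary p (p i) k = (k == i)%:R.
Proof.
move=> pU; have S1 : \sum_(k < d.+1) (k == i)%:R = 1 :> R.
  by rewrite (bigD1 i)//= eqxx big1 ?addr0// => j /negPf->.
rewrite -(bary_affine_comb pU S1 k); congr (bary p _ k).
rewrite (bigD1 i)//= eqxx scale1r big1 ?addr0// => j /negPf->.
by rewrite scale0r.
Qed.

Lemma simplexP p x : edge_mx p \in unitmx ->
  simplex p x <-> forall i, 0 <= bary p x i.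
Proof.
move=> pU; split=> [[l [l0 _ l1 ->]] i|b0].
  by rewrite bary_affine_comb.
exists (bary p x); split=> //; first by move=> i; rewrite !inE.
  exact: bary_sum1.
by rewrite bary_reconstruct.
Qed.

(** The vectors [qvec p (lift ord0 k)] are the rows of an inverse matrix, hence
    independent, so the relation [qvec_sum0] is the only one up to a factor. *)
Lemma qvec_comb_eq0 p c : edge_mx p \in unitmx ->
  \sum_i c i *: qvec p i = 0 -> forall i, c i = c ord0.
Proof.
move=> pU c0 i.
have : \sum_i (c i - c ord0) *: qvec p i = 0.
  under eq_bigr => j _ do rewrite scalerBl.
  by rewrite sumrB c0 -scaler_sumr qvec_sum0 scaler0 subrr.
rewrite big_ord_recl subrr scale0r add0r => H.
have {}H : (invmx (edge_mx p))^T *m (\col_k (c (lift ord0 k) - c ord0)) = 0.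
  rewrite -[RHS]H; apply/colP => r; rewrite mxE summxE; apply: eq_bigr => k _.
  by rewrite qvec_lift !mxE mulrC.
have := congr1 (mulmx (edge_mx p)^T) H.
rewrite mulmxA -trmx_mul mulVmx// trmx1 mul1mx mulmx0 => /colP E.
case: (unliftP ord0 i) => [k|] -> //.
by have := E k; rewrite !mxE => /eqP; rewrite subr_eq0 => /eqP.
Qed.

Lemma bary_barycenter p i :
  edge_mx p \in unitmx -> bary p (barycenter p) i = (d.+1%:R)^-1.
Proof.
move=> pU; rewrite /barycenter scaler_sumr (@bary_affine_comb _ (fun=> _))//.
by rewrite sumr_const card_ord -[X in X = _]mulr_natr mulVf.
Qed.

(** Barycentric coordinates are invariant under affine maps, so their gradients
    transform by the inverse transpose of the Jacobian. *)
Lemma qvec_affine_image p q i : edge_mx p \in unitmx -> edge_mx q \in unitmx ->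
  qvec p i = (invmx (edge_mx p *m invmx (edge_mx q)))^T *m qvec q i.
Proof.
move=> pU qU; have -> : invmx (edge_mx p *m invmx (edge_mx q)) =
    edge_mx q *m invmx (edge_mx p).
  have U : edge_mx p *m invmx (edge_mx q) \in unitmx.
    by rewrite unitmx_mul pU unitmx_inv.
  apply: (can_inj (mulKmx U)); rewrite mulmxV// mulmxA.
  by rewrite -(mulmxA (edge_mx p)) mulVmx// mulmx1 mulmxV.
have E k : col k (invmx (edge_mx p))^T =
    (edge_mx q *m invmx (edge_mx p))^T *m col k (invmx (edge_mx q))^T.
  by rewrite !colE mulmxA -trmx_mul mulmxA mulVmx// mul1mx.
rewrite /qvec; case: unliftP => [k|] _; first exact: E.
by rewrite mulmxN mulmx_sumr; congr (- _); apply: eq_bigr => k _; exact: E.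
Qed.

Lemma linear_form_continuous (a : 'I_d -> R) :
  continuous (fun x : 'cV[R]_d => \sum_r a r * x r 0).
Proof.
elim: (index_enum _) => [|r s IH].
  have -> : (fun x => \sum_(r <- [::]) a r * x r 0) = cst 0.
    by apply/funext => x; rewrite big_nil.
  exact: cst_continuous.
have -> : (fun x => \sum_(r <- r :: s) a r * x r 0) =
    (fun x => a r * x r 0 + \sum_(r <- s) a r * x r 0).
  by apply/funext => x; rewrite big_cons.
move=> x; apply: continuousD (IH x).
by apply: continuousM; [exact: cst_continuous | exact: coord_continuous].
Qed.

Lemma bary_continuous p i : continuous (fun x => bary p x i).
Proof.
have -> : (fun x => bary p x i) =
    (fun x => bary p 0 i + \sum_r qvec p i r 0 * x r 0).
  apply/funext => y; rewrite -[LHS](subrK (bary p 0 i)) addrC baryB subr0.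
  by rewrite mx11_dotE.
move=> x; apply: continuousD; first exact: cst_continuous.
exact: linear_form_continuous.
Qed.

Lemma homothety_continuous (a : 'cV[R]_d) (t : R) :
  continuous (fun y : 'cV[R]_d => a + t *: (y - a)).
Proof.
move=> x; apply: (@continuousD _ _ _ (fun=> a)
  (fun y : 'cV[R]_d => t *: (y - a))); first exact: cst_continuous.
apply: (@continuousZl_tmp _ _ _ (fun y : 'cV[R]_d => y - a) t).
by apply: continuousB; [by [] | exact: cst_continuous].
Qed.

End Simplex.

(** * Conforming meshes and stars of interior vertices *)

Section MeshGeometry.
Set Implicit Arguments.
Unset Strict Implicit.
Unset Printing Implicit Defensive.
Context (R : realType) (d : nat) (Omega : set 'cV[R]_d) (T : mesh R d).
Hypothesis hT : triangulation T Omega.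
Implicit Types (K : 'I_(nelt T)) (j : 'I_(nv T)) (x y : 'cV[R]_d).

Let nondegK K : edge_mx (evtx K) \in unitmx := tri_nondegenerate hT K.

(** Barycentric coordinates of [x] in [K], indexed by the vertices of the whole
    mesh so that those of different elements can be compared. *)
Definition weight K x j : R := \sum_(i | loc K i == j) bary (evtx K) x i.

Lemma loc_inj K : injective (loc K).
Proof.
move=> i i' ii'; have e : evtx K i = evtx K i' by rewrite /evtx ii'.
have := bary_vertex i i (nondegK K); rewrite e bary_vertex// eqxx.
by case: eqP => // _ /eqP; rewrite eq_sym oner_eq0.
Qed.

Lemma loc_vset K i : loc K i \in vset K.
Proof. exact: imset_f. Qed.

Lemma weight_loc K x i : weight K x (loc K i) = bary (evtx K) x i.
Proof.
rewrite /weight (big_pred1 i)// => i'.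
by rewrite /= (inj_eq (@loc_inj K)).
Qed.

Lemma weight_out K x j : j \notin vset K -> weight K x j = 0.
Proof.
move=> jK; rewrite /weight big_pred0// => i.
by apply: contraNF jK => /eqP <-; exact: loc_vset.
Qed.

Lemma sum_vset (V : nmodType) (F : 'I_(nv T) -> V) K :
  (forall j, j \notin vset K -> F j = 0) -> \sum_j F j = \sum_i F (loc K i).
Proof.
move=> F0; rewrite (bigID (mem (vset K)))/= [X in _ + X]big1// addr0.
by rewrite big_imset//= => i i' _ _; exact: loc_inj.
Qed.

(** A common point of two elements is a convex combination of their common
    vertices, and barycentric coordinates in either element are unique.  This is
    what makes [phi] independent of the element picked in its definition. *)
Lemma weight_conforming K K' x :
  elt K x -> elt K' x -> weight K x =1 weight K' x.
Proof.
move=> Kx K'x.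
have : (elt K `&` elt K') x by [].
rewrite (tri_conforming hT) => -[l [_ l0 l1 xE]].
have wE K0 : (vset K :&: vset K' \subset vset K0)%SET -> weight K0 x =1 l.
  move=> /fintype.subsetP sub j.
  have lout i : i \notin vset K0 -> l i = 0.
    by move=> iK; apply: l0; apply: contra iK; exact: sub.
  have [/imsetP[i _ ->]|jK] := boolP (j \in vset K0); last first.
    by rewrite weight_out// lout.
  rewrite weight_loc xE (@sum_vset _ (fun j => l j *: vtx j) K0).
    rewrite (bary_affine_comb _ (l := fun i => l (loc K0 i)))//.
    by rewrite -(@sum_vset _ l K0).
  by move=> i' iK; rewrite lout// scale0r.
by move=> j; rewrite !wE ?finset.subsetIl ?finset.subsetIr.
Qed.

Lemma phi_elt K x j : elt K x -> phi j x = weight K x j.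
Proof.
move=> Kx; rewrite /phi; case: pickP => [K'|/(_ K)]; last by rewrite mem_set.
by move=> /set_mem K'x; exact: weight_conforming.
Qed.

Lemma fe_elt (c : 'I_(nv T) -> R) K x : elt K x ->
  \sum_j c j * phi j x = \sum_i c (loc K i) * bary (evtx K) x i.
Proof.
move=> Kx; under eq_bigr => j _ do rewrite (phi_elt j Kx).
rewrite (@sum_vset _ (fun j => c j * weight K x j) K) => [|j jK].
  by apply: eq_bigr => i _; rewrite weight_loc.
by rewrite weight_out// mulr0.
Qed.

Lemma elt_vertex K i : elt K (evtx K i).
Proof. by apply/simplexP => // k; rewrite bary_vertex// ler0n. Qed.

Lemma vset_elt K j : elt K (vtx j) -> j \in vset K.
Proof.
move=> Kj; have [K' /imsetP[i _ jE]] := tri_vtx_used hT j.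
apply/negPn/negP => /(weight_out (vtx j)).
rewrite (weight_conforming (K' := K'))//; last by rewrite jE; exact: elt_vertex.
rewrite [X in weight _ _ X]jE weight_loc jE bary_vertex// eqxx.
by move/eqP; rewrite oner_eq0.
Qed.

Lemma elt_closure K x : elt K x -> closure Omega x.
Proof. by move=> Kx; rewrite (tri_cover hT); exists K. Qed.

Lemma fe_vtx (c : 'I_(nv T) -> R) j : \sum_j' c j' * phi j' (vtx j) = c j.
Proof.
have [K /imsetP[i _ ->]] := tri_vtx_used hT j.
rewrite (fe_elt _ (elt_vertex K i)) (bigD1 i)//= bary_vertex// eqxx mulr1.
rewrite big1 ?addr0// => k /negPf ki.
by rewrite bary_vertex// ki mulr0.
Qed.

Hypothesis OmegaR : regopen Omega.

(** There are finitely many elements and each is closed, so those that miss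
    [vtx j] stay away from it; by conformity an element containing [vtx j] has
    it as a vertex. *)
Lemma vertex_star j : (j < nvi T)%N ->
  \forall y \near vtx j, exists2 K, j \in vset K & elt K y.
Proof.
move=> jint; have Oj := tri_interior hT jint.
have near_out : \forall y \near vtx j, forall K, elt K y -> elt K (vtx j).
  apply: (@filter_forall _ _ (fun K y => elt K y -> elt K (vtx j))
    _ (nbhs_filter _)) => K.
  have [Kj|nKj] := pselect (elt K (vtx j)); first by near=> y.
  have [i bi] : exists i, bary (evtx K) (vtx j) i < 0.
    apply: contrapT => nb; apply: nKj; apply/simplexP => // i.
    by rewrite leNgt; apply/negP => bi; apply: nb; exists i.
  near=> y => /(simplexP _ (nondegK K))/(_ i); rewrite leNgt => /negP[].
  near: y; exact: (cvgr_lt _ (@bary_continuous _ _ (evtx K) i (vtx j))).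
have near_cl : \forall y \near vtx j, closure Omega y.
  by move: Oj; rewrite -{1}OmegaR.
near=> y.
have : closure Omega y by near: y.
rewrite (tri_cover hT) => -[K _ Ky]; exists K => //; apply: vset_elt.
by move: K Ky; near: y.
Unshelve. all: by end_near. Qed.

Lemma bary_homothety K j (t : R) y i : j \in vset K ->
  bary (evtx K) (vtx j + t *: (y - vtx j)) i =
  (1 - t) * (loc K i == j)%:R + t * bary (evtx K) y i.
Proof.
move=> /imsetP[i0 _ ->]; rewrite bary_segment (inj_eq (@loc_inj K)).
by rewrite bary_vertex.
Qed.

(** If [x] lies in the cone that [K'] spans from its vertex [j], then points
    close to [vtx j] on the segment to [x] lie in [K'], and in [K] by convexity.
    Their weights at [j] agree in both elements, hence so do those of [x], as
    weights are affine along the segment. *)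
Lemma star_weight_gt0 K K' x j : elt K x -> 0 < weight K x j ->
  j \in vset K' ->
  (forall i, loc K' i != j -> 0 <= bary (evtx K') x i) -> 0 < weight K' x j.
Proof.
move=> Kx wx jK' b0.
have jK : j \in vset K by apply: contraLR wx => /weight_out ->; rewrite ltxx.
have [t [t0 t1 wt]] : exists t : R,
    [/\ 0 < t, t <= 1 & 0 <= 1 - t + t * weight K' x j].
  (* With t (1 + |b|) = 1 the bound amounts to |b| + b >= 0. *)
  set b := weight K' x j; have b1 : 0 < 1 + `|b| by rewrite ltr_wpDr.
  exists (1 + `|b|)^-1; split; first by rewrite invr_gt0.
    by rewrite invf_le1// lerDl.
  rewrite -(pmulr_rge0 _ b1) mulrDr mulrBr mulr1 mulfV ?gt_eqF//.
  rewrite mulVKf ?gt_eqF// [1 + _]addrC addrK -lerBlDr sub0r -normrN.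
  exact: ler_norm.
have wE K0 : j \in vset K0 ->
    weight K0 (vtx j + t *: (x - vtx j)) j = 1 - t + t * weight K0 x j.
  move=> jK0; have /imsetP[i _ jE] := jK0.
  have wi z : weight K0 z j = bary (evtx K0) z i by rewrite jE weight_loc.
  by rewrite !wi bary_homothety// -jE eqxx mulr1.
have t1' : 0 <= 1 - t by rewrite subr_ge0.
have Kh : elt K (vtx j + t *: (x - vtx j)).
  apply/simplexP => // i; rewrite bary_homothety//.
  have /simplexP := Kx => /(_ (nondegK K) i) xi.
  by rewrite addr_ge0// mulr_ge0// ltW.
have K'h : elt K' (vtx j + t *: (x - vtx j)).
  apply/simplexP => // i; rewrite bary_homothety//.
  have [ij|ij] := eqVneq (loc K' i) j; last first.
    by rewrite mulr0 add0r; apply: mulr_ge0; [exact: ltW | exact: b0].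
  by rewrite mulr1 -weight_loc ij.
have := weight_conforming Kh K'h j.
by rewrite !wE// => /addrI /(mulfI (lt0r_neq0 t0)) <-.
Qed.

(** A homothety centred at [vtx j] shrinks a neighbourhood of [x] into the
    region covered by the elements around [vtx j], so that each [y] near [x] lies
    in the cone of such an element [K'].  To conclude that [y] is in [K'] itself,
    its weight at [j] has to be positive, which [star_weight_gt0] gives at [x]
    and continuity near [x].  Thus [x] is interior to [closure Omega]. *)
Lemma open_star K x j : (j < nvi T)%N -> elt K x -> 0 < weight K x j -> Omega x.
Proof.
move=> jint Kx wx; rewrite -OmegaR.
suff : \forall y \near x, closure Omega y by [].
pose h (t : R) y := vtx j + t *: (y - vtx j).
have h_cvg0 : h t x @[t --> 0^'+] --> vtx j.
  apply: cvg_at_right_filter; rewrite /h.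
  have -> : nbhs (vtx j) = nbhs (vtx j + 0 *: (x - vtx j)).
    by rewrite scale0r addr0.
  by apply: cvgD; [exact: cvg_cst | apply: cvgZr_tmp; exact: cvg_id].
have star0 := nbhs_interior (vertex_star jint).
have [t [t0 ht]] : exists t : R, 0 < t /\
    \forall z \near h t x, exists2 K', j \in vset K' & elt K' z.
  apply: (@filter_ex _ (0 : R)^'+); near=> t.
  split; first by near: t; exact: nbhs_right_gt.
  by near: t; exact: (h_cvg0 _ star0).
have hc : h t y @[y --> x] --> h t x.
  exact: homothety_continuous.
have near_pos : \forall y \near x, forall K', j \in vset K' ->
    (exists2 i, loc K' i != j & bary (evtx K') y i < 0) \/ 0 < weight K' y j.
  apply: (@filter_forall _ _ (fun K' y => j \in vset K' ->
    (exists2 i, loc K' i != j & bary (evtx K') y i < 0) \/ 0 < weight K' y j)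
    _ (nbhs_filter _)) => K'.
  have [jK'|] := boolP (j \in vset K'); last by move=> _; near=> y.
  have [[i ij bi]|nb] :=
      pselect (exists2 i, loc K' i != j & bary (evtx K') x i < 0).
    near=> y => _; left; exists i => //; near: y.
    exact: (cvgr_lt _ (@bary_continuous _ _ (evtx K') i x)).
  have : 0 < weight K' x j.
    apply: (star_weight_gt0 Kx) => // i ij.
    by rewrite leNgt; apply/negP => bi; apply: nb; exists i.
  have /imsetP[i _ ->] := jK'; rewrite weight_loc => bi.
  near=> y => _; right; rewrite weight_loc; near: y.
  exact: (cvgr_gt _ (@bary_continuous _ _ (evtx K') i x)).
have near_star := hc _ ht.
near=> y.
have [K' jK' /(simplexP _ (nondegK K')) K'h] :
    exists2 K', j \in vset K' & elt K' (h t y) by near: y.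
have b0 i : loc K' i != j -> 0 <= bary (evtx K') y i.
  move=> ij; have := K'h i.
  by rewrite bary_homothety// (negPf ij) mulr0 add0r pmulr_rge0.
apply: (elt_closure (K := K')); apply/simplexP => // i.
have [ij|] := eqVneq (loc K' i) j; last exact: b0.
rewrite -weight_loc ij; apply: ltW.
have [[i' /b0]|//] :
    (exists2 i, loc K' i != j & bary (evtx K') y i < 0) \/ 0 < weight K' y j.
  by move: K' jK' {K'h b0 ij}; near: y.
by rewrite leNgt => /negP.
Unshelve. all: by end_near. Qed.

Lemma frontier_phi_eq0 x j : (j < nvi T)%N -> frontier Omega x -> phi j x = 0.
Proof.
move=> jint [+ nOx]; rewrite (tri_cover hT) => -[K _ Kx].
rewrite (phi_elt j Kx); apply/eqP; rewrite eq_le; apply/andP; split; last first.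
  by apply: sumr_ge0 => i _; have /simplexP := Kx; apply.
rewrite leNgt; apply/negP => /(open_star jint Kx) Ox; apply: nOx.
have oO : open Omega by rewrite -OmegaR; exact: open_interior.
exact: open_nbhs_nbhs.
Qed.

End MeshGeometry.

(** * Quadratic forms *)

Section QuadraticForms.
Set Implicit Arguments.
Unset Strict Implicit.
Unset Printing Implicit Defensive.
Context (R : realType) (d : nat).

(** Subtracting [gp] from the second factor leaves the negative parts of [z], so
    the difference of the two sides is a sum of products of a positive part, a
    negative part and an entry of the Gram matrix.  On the diagonal one of the
    two parts is zero; off the diagonal all signs are known. *)
Lemma nonobtuse_energy (n : nat) (q : 'I_n -> 'cV[R]_d)
    (A : 'M[R]_d) (z : 'I_n -> R) :
  (forall i j, i != j -> ((q i)^T *m A *m q j) 0 0 <= 0) ->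
  ((\sum_i Num.max 0 (z i) *: q i)^T *m A *m
    \sum_i Num.max 0 (z i) *: q i) 0 0 <=
  ((\sum_i Num.max 0 (z i) *: q i)^T *m A *m \sum_i z i *: q i) 0 0.
Proof.
move=> offdiag; set gp := \sum_i Num.max 0 (z i) *: q i; rewrite -subr_ge0.
have -> : (gp^T *m A *m \sum_i z i *: q i) 0 0 - (gp^T *m A *m gp) 0 0 =
    \sum_j \sum_i Num.max 0 (z i) * (z j - Num.max 0 (z j)) *
      ((q i)^T *m A *m q j) 0 0.
  have -> : (gp^T *m A *m \sum_i z i *: q i) 0 0 - (gp^T *m A *m gp) 0 0 =
      (gp^T *m A *m \sum_j (z j - Num.max 0 (z j)) *: q j) 0 0.
    under [in RHS]eq_bigr => j _ do rewrite scalerBl.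
    by rewrite sumrB mulmxBr [RHS]mxE; congr (_ + _); rewrite [RHS]mxE.
  rewrite mulmx_sumr summxE; apply: eq_bigr => j _.
  rewrite -scalemxAr mxE [X in (X *m _ *m _)]linear_sum !mulmx_suml summxE.
  rewrite mulr_sumr.
  apply: eq_bigr => i _.
  by rewrite linearZ /= -!scalemxAl mxE mulrA [_ * Num.max _ _]mulrC.
apply: sumr_ge0 => j _; apply: sumr_ge0 => i _.
have z0 : 0 <= Num.max 0 (z i) by rewrite le_max lexx.
have [->|ij] := eqVneq i j.
  rewrite /Num.max; case: ifP => _; first by rewrite subrr mulr0 mul0r.
  by rewrite !mul0r.
rewrite -mulrA mulr_ge0// mulr_le0 ?offdiag// subr_le0.
by rewrite le_max lexx orbT.
Qed.

Lemma spd_convex_comb (m : nat) (w : 'I_m -> R)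
    (A : 'I_m -> 'M[R]_d) :
  \sum_k w k = 1 -> (forall k, 0 <= w k) -> (forall k, spd (A k)) ->
  forall x : 'cV[R]_d, x != 0 -> 0 < (x^T *m (\sum_k w k *: A k) *m x) 0 0.
Proof.
move=> w1 w0 Aspd x x0.
have -> : (x^T *m (\sum_k w k *: A k) *m x) 0 0 =
    \sum_k w k * (x^T *m A k *m x) 0 0.
  rewrite mulmx_sumr mulmx_suml summxE; apply: eq_bigr => k _.
  by rewrite -scalemxAr -scalemxAl mxE.
have pos k : 0 < (x^T *m A k *m x) 0 0 by apply: (Aspd k).2.
have ge k : 0 <= w k * (x^T *m A k *m x) 0 0 by rewrite mulr_ge0// ltW.
rewrite lt_neqAle sumr_ge0// andbT eq_sym; apply/negP => /eqP s0.
have := oner_neq0 R; rewrite -w1 big1 ?eqxx// => k _; apply/eqP.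
have /eqP := psumr_eq0P (fun k _ => ge k) s0 (erefl : xpredT k).
by rewrite mulf_eq0 (gt_eqF (pos k)) orbF.
Qed.

End QuadraticForms.

(** * Finite element functions *)

Section FiniteElements.
Set Implicit Arguments.
Unset Strict Implicit.
Unset Printing Implicit Defensive.
Context (R : realType) (d : nat) (Omega : set 'cV[R]_d) (T : mesh R d).
Hypothesis hT : triangulation T Omega.
Implicit Types (K : 'I_(nelt T)) (j : 'I_(nv T)) (c : 'I_(nv T) -> R).

Let nondegK K : edge_mx (evtx K) \in unitmx := tri_nondegenerate hT K.

Lemma derive_affine_near (v : 'cV[R]_d -> R)
    (a b e : 'cV[R]_d) :
  (\forall y \near a, v y = v a + (b^T *m (y - a)) 0 0) ->
  'D_e v a = (b^T *m e) 0 0.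
Proof.
move=> vE; rewrite (near_eq_derive _ vE) /derive.
apply: norm_lim_near_cst; near=> h.
have h0 : h != 0 by near: h; exact: nbhs_dnbhs_neq.
rewrite /= subrr mulmx0 [in X in _ + X]mxE addr0 addrAC subrr add0r addrK.
by rewrite -scalemxAr mxE /GRing.scale/= mulKf.
Unshelve. all: by end_near. Qed.

(** Near the barycenter all barycentric coordinates are positive, so only [K] is
    seen and the finite element function is affine there. *)
Lemma gradK_fe c K : gradK (fun x => \sum_j c j * phi j x) K =
  \sum_i c (loc K i) *: qvec (evtx K) i.
Proof.
have bary_gt0 i : 0 < bary (evtx K) (barycenter (evtx K)) i.
  by rewrite bary_barycenter// invr_gt0 ltr0n.
have near_elt : \forall y \near barycenter (evtx K), elt K y.
  have : \forall y \near barycenter (evtx K), forall i, 0 < bary (evtx K) y i.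
    apply: (@filter_forall _ _ (fun i y => 0 < bary (evtx K) y i)
      _ (nbhs_filter _)) => i.
    exact: (cvgr_gt _ (@bary_continuous _ _ (evtx K) i _)).
  move=> near_gt0; near=> y; apply/simplexP => // i; apply: ltW.
  by move: i; near: y.
apply/colP => r; rewrite /gradK /grad mxE.
rewrite (@derive_affine_near _ _ (\sum_i c (loc K i) *: qvec (evtx K) i)).
  set b := \sum_i _; rewrite mx11_dotE (bigD1 r)//= mxE !eqxx mulr1.
  rewrite big1 ?addr0// => k /negPf kr.
  by rewrite mxE kr mulr0.
near=> y.
have Ky : elt K y by near: y.
rewrite (fe_elt hT _ Ky) (fe_elt hT _ (K := K)); last first.
  by apply/simplexP => // i; exact: ltW.
rewrite linear_sum/= mulmx_suml summxE -big_split/=; apply: eq_bigr => i _.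
by rewrite linearZ/= -scalemxAl mxE -mulrDr -baryB addrC subrK.
Unshelve. all: by end_near. Qed.

Lemma fe_le c (B : R) x : closure Omega x -> (forall j, c j <= B) ->
  \sum_j c j * phi j x <= B.
Proof.
rewrite (tri_cover hT) => -[K _ Kx] cB; rewrite (fe_elt hT _ Kx).
rewrite -[leRHS]mulr1 -(bary_sum1 (evtx K) x) mulr_sumr.
apply: ler_sum => i _; apply: ler_wpM2r => //.
by have /simplexP := Kx; apply.
Qed.

Lemma phi_ge0 j x : closure Omega x -> 0 <= phi j x.
Proof.
rewrite (tri_cover hT) => -[K _ Kx]; rewrite (phi_elt hT j Kx).
by apply: sumr_ge0 => i _; have /simplexP := Kx; apply.
Qed.

Lemma qnode_elt (ahat : 'I_d.+1 -> 'cV[R]_d) (m : nat) (bhat : 'I_m -> 'cV[R]_d)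
    K k :
  edge_mx ahat \in unitmx -> simplex ahat (bhat k) ->
  elt K (qnode T ahat bhat K k).
Proof.
move=> aU /(simplexP _ aU) b0; apply/simplexP => // i.
have -> : bary (evtx K) (qnode T ahat bhat K k) i = bary ahat (bhat k) i;
  last by [].
have E : invmx (edge_mx (evtx K)) *m (qnode T ahat bhat K k - evtx K ord0) =
    invmx (edge_mx ahat) *m (bhat k - ahat ord0).
  by rewrite /qnode /mapF addrAC subrr add0r /jacF -mulmxA mulKmx.
by rewrite /bary E.
Qed.

Hypothesis OmegaR : regopen Omega.

(** A vertex with nonzero value that maximizes the first coordinate among those is interior.
    One of the elements around it contains points with larger first coordinate,
    although all its vertices carry the same nonzero value. *)
Lemma elementwise_constant_eq0 c : (0 < d)%N ->
  (forall j, (nvi T <= j)%N -> c j = 0) ->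
  (forall K i i', c (loc K i) = c (loc K i')) -> forall j, c j = 0.
Proof.
move=> d0 cbd ccst j0; apply/eqP/negPn/negP => cj0.
pose r0 : 'I_d := Ordinal d0.
case: (@arg_maxP _ _ _ j0 (fun j => c j != 0) (fun j => vtx j r0 0) cj0).
move=> j cj jmax.
have jint : (j < nvi T)%N.
  by rewrite ltnNge; apply: contra cj => /cbd ->.
have line_cvg : vtx j + t *: delta_mx r0 0 @[t --> (0 : R)^'+] --> vtx j.
  apply: cvg_at_right_filter.
  have -> : nbhs (vtx j) = nbhs (vtx j + 0 *: delta_mx r0 0).
    by rewrite scale0r addr0.
  by apply: cvgD; [exact: cvg_cst | apply: cvgZr_tmp; exact: cvg_id].
have [t [t0 [K jK Kt]]] : exists t : R, 0 < t /\
    exists2 K, j \in vset K & elt K (vtx j + t *: delta_mx r0 0).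
  apply: (@filter_ex _ (0 : R)^'+); near=> t.
  split; first by near: t; exact: nbhs_right_gt.
  by near: t; exact: (line_cvg _ (vertex_star hT OmegaR jint)).
have /imsetP[i0 _ jE] := jK.
have : (vtx j + t *: delta_mx r0 0) r0 0 <= vtx j r0 0.
  rewrite -(bary_reconstruct (vtx j + t *: delta_mx r0 0) (nondegK K)) summxE.
  rewrite -[leRHS]mul1r -(bary_sum1 (evtx K) (vtx j + t *: delta_mx r0 0)).
  rewrite mulr_suml; apply: ler_sum => i _; rewrite mxE.
  apply: ler_wpM2l; first by have /simplexP := Kt; apply.
  by apply: jmax; rewrite (ccst K i i0) -jE.
by rewrite !mxE !eqxx mulr1 gerDl leNgt t0.
Unshelve. all: by end_near. Qed.

End FiniteElements.

(** * Discrete energy and the maximum principle *)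

Section Energy.
Set Implicit Arguments.
Unset Strict Implicit.
Unset Printing Implicit Defensive.
Context (R : realType) (d : nat) (Omega : set 'cV[R]_d) (T : mesh R d).
Hypotheses (hT : triangulation T Omega) (OmegaR : regopen Omega).
Context (ahat : 'I_d.+1 -> 'cV[R]_d) (m : nat) (w : 'I_m -> R).
Context (bhat : 'I_m -> 'cV[R]_d) (D : 'cV[R]_d -> 'M[R]_d).
Hypothesis ahatU : edge_mx ahat \in unitmx.
Implicit Types (K : 'I_(nelt T)) (j : 'I_(nv T)) (c : 'I_(nv T) -> R).

Let nondegK K : edge_mx (evtx K) \in unitmx := tri_nondegenerate hT K.

Lemma nonobtuse_qvec K (i j : 'I_d.+1) :
  nonobtuse_condition T ahat w bhat D -> i != j ->
  ((qvec (evtx K) i)^T *m DK ahat w bhat D K *m qvec (evtx K) j) 0 0 <= 0.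
Proof.
move=> obt /(obt K).
by rewrite !(qvec_affine_image _ (nondegK K) ahatU) trmx_mul trmxK !mulmxA.
Qed.

Lemma interior_fe_in_U0h c : (forall j, (nvi T <= j)%N -> c j = 0) ->
  U0h T (fun x => \sum_(j : 'I_(nv T)) c j * phi j x).
Proof.
move=> c0; exists c; apply/funext => x.
rewrite (bigID (fun j : 'I__ => (j < nvi T)%N))/=
  [X in _ + X]big1 ?addr0// => j.
by rewrite -leqNgt => /c0 ->; rewrite mul0r.
Qed.

(** At a node in [Omega] the sign of [f] decides; on the boundary the interior
    basis functions vanish. *)
Lemma load_le0 (f : 'cV[R]_d -> R) c K :
  (forall k, 0 <= w k) -> (forall k, simplex ahat (bhat k)) ->
  (forall x, Omega x -> f x <= 0) ->
  (forall j, 0 <= c j) -> (forall j, (nvi T <= j)%N -> c j = 0) ->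
  \sum_k w k * f (qnode T ahat bhat K k) *
    \sum_j c j * phi j (qnode T ahat bhat K k) <= 0.
Proof.
move=> w0 hb f0 c0 cbd; apply: sumr_le0 => k _.
set x := qnode T ahat bhat K k.
have clx : closure Omega x.
  by apply: (elt_closure hT (K := K)); exact: (qnode_elt hT).
rewrite -mulrA; apply: mulr_ge0_le0 => //.
have [Ox|nOx] := pselect (Omega x).
  apply: mulr_le0_ge0; first exact: f0.
  by apply: sumr_ge0 => j _; rewrite mulr_ge0// (phi_ge0 hT).
rewrite [X in _ * X]big1 ?mulr0// => j _.
have [jint|/cbd ->] := ltnP j (nvi T); last by rewrite mul0r.
rewrite (frontier_phi_eq0 hT) ?mulr0//; split=> //.
by move=> /interior_subset.
Qed.

End Energy.

Theorem theorem2p2 (R : realType) (d : nat) (hd : (1 <= d <= 3)%N)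
  (Omega : set 'cV[R]_d) (hOmega : polytopal_domain Omega)
  (f g : 'cV[R]_d -> R)
  (D : 'cV[R]_d -> 'M[R]_d) (hD : forall x, Omega x -> spd (D x))
  (T : mesh R d) (hT : triangulation T Omega)
  (ahat : 'I_d.+1 -> 'cV[R]_d) (hahat : edge_mx ahat \in unitmx)
  (m : nat) (w : 'I_m -> R) (bhat : 'I_m -> 'cV[R]_d)
  (hw1 : \sum_k w k = 1) (hw0 : forall k, 0 <= w k)
  (hbhat : forall k, simplex ahat (bhat k))
  (hDb : forall K k, frontier Omega (qnode T ahat bhat K k) ->
           spd (D (qnode T ahat bhat K k)))
  (hobt : nonobtuse_condition T ahat w bhat D) :
  dmp T ahat w bhat D f g Omega.
Proof.
have d0 : (0 < d)%N by case/andP: hd.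
have [[x0 Ox0] _ _ OmegaR _] := hOmega.
move=> f0 uh [u [-> _ uP]].
set v := fun x => \sum_j u j * phi j x.
set M := Num.max 0 _.
have v_ub : has_ubound (v @` frontier Omega).
  exists (\sum_j `|u j|) => _ [x [clx _] <-]; apply: (fe_le hT) => // j.
  rewrite (le_trans (ler_norm _))// (bigD1 j)//= lerDl.
  by apply: sumr_ge0.
have u_bd (j : 'I_(nv T)) : (nvi T <= j)%N -> u j <= M.
  move=> jbd; rewrite le_max; apply/orP; right; apply: ub_le_sup => //.
  by exists (vtx j); [exact: tri_boundary hT _ jbd | exact: fe_vtx hT _ _].
suff u_le j : u j <= M.
  apply: ge_sup; first by exists (v x0); exists x0 => //; exact: subset_closure.
  by move=> _ [x clx <-]; apply: (fe_le hT).
pose c j := Num.max 0 (u j - M).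
suff : c j = 0 by rewrite -subr_le0 => <-; rewrite /c le_max lexx orbT.
have c_ge0 i : 0 <= c i by rewrite /c le_max lexx.
have c_bd (i : 'I_(nv T)) : (nvi T <= i)%N -> c i = 0.
  by move=> /u_bd; rewrite -subr_le0 /c => /max_l ->.
move: j; apply: (elementwise_constant_eq0 hT OmegaR d0 c_bd) => K.
(* The gradient on an element of the test function with nodal values c. *)
pose gc (K' : 'I_(nelt T)) := \sum_i c (loc K' i) *: qvec (evtx K') i.
pose A (K' : 'I_(nelt T)) := DK ahat w bhat D K'.
have Apos K' (x : 'cV[R]_d) : x != 0 -> 0 < (x^T *m A K' *m x) 0 0.
  apply: (spd_convex_comb hw1 hw0) => // k.
  set y := qnode T ahat bhat K' k.
  have cly : closure Omega y.
    by apply: (elt_closure hT (K := K')); exact: (qnode_elt hT).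
  have [/hD //|nOy] := pselect (Omega y).
  by apply: hDb; split=> // /interior_subset.
have Age0 K' : 0 <= volume (evtx K') * ((gc K')^T *m A K' *m gc K') 0 0.
  apply: mulr_ge0; first by rewrite divr_ge0.
  have [->|/Apos/ltW//] := eqVneq (gc K') 0.
  by rewrite mulmx0 mxE.
have energy_le0 : \sum_K' volume (evtx K') *
    ((gc K')^T *m A K' *m gc K') 0 0 <= 0.
  have := uP _ (interior_fe_in_U0h c_bd) => uPc.
  have : \sum_K' volume (evtx K') * \sum_k w k * f (qnode T ahat bhat K' k) *
     \sum_j c j * phi j (qnode T ahat bhat K' k) <= 0.
    apply: sumr_le0 => K' _; apply: mulr_ge0_le0; first by rewrite divr_ge0.
    exact: (load_le0 hT).
  rewrite -uPc; apply: le_trans; apply: ler_sum => K' _.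
  apply: ler_wpM2l; first by rewrite divr_ge0.
  rewrite !(gradK_fe hT) -/(A K').
  (* The q-vectors add up to zero, so constants may be subtracted from the nodal
     values. *)
  have -> : \sum_i u (loc K' i) *: qvec (evtx K') i =
      \sum_i (u (loc K' i) - M) *: qvec (evtx K') i.
    under [RHS]eq_bigr => i _ do rewrite scalerBl.
    by rewrite sumrB -scaler_sumr qvec_sum0 scaler0 subr0.
  apply: nonobtuse_energy => i j; exact: (nonobtuse_qvec hT).
have gc0 : gc K = 0.
  apply/eqP/negPn/negP => /Apos gpos.
  have e0 : \sum_K' volume (evtx K') * ((gc K')^T *m A K' *m gc K') 0 0 = 0.
    by apply: le_anti; rewrite energy_le0 sumr_ge0.
  have /(_ K isT)/eqP := psumr_eq0P (fun K' _ => Age0 K') e0.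
  rewrite mulf_eq0 (gt_eqF (gpos K)) orbF /volume mulf_eq0 invr_eq0 pnatr_eq0.
  rewrite eqn0Ngt fact_gt0 orbF normr_eq0.
  by have := tri_nondegenerate hT K; rewrite unitmxE unitfE => /negPf ->.
have cst i := qvec_comb_eq0 (tri_nondegenerate hT K) gc0 i.
by move=> i i'; rewrite cst [RHS]cst.
Qed.
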